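(* Let $G$ be a real matrix Lie group with Lie algebra $\mathfrak g$, and let $p_1\in I^2(\mathfrak g)$ be the first Pontryagin polynomial. For $n\ge 0$ let $\chi_n=\int_{\Delta^n}p_1\circ(\kappa_n\wedge\kappa_n)\in\Omega^{4-n}(EG_n)$ be the forms obtained by applying Shulman's construction to $p_1$. Then $$\chi_1=\frac{1}{24\pi^2}\,\mathrm{Tr}(\bar\omega_1\cdot\bar\omega_1\cdot\bar\omega_1),$$ $$\chi_2=\frac{1}{8\pi^2}\left(\mathrm{Tr}(\bar\omega_1\cdot\bar\omega_2)-\mathrm{Tr}(\bar\omega_1)\cdot\mathrm{Tr}(\bar\omega_2)\right),$$ $$\chi_n=0\quad\text{for all } n\neq 1,2,$$ where $\bar\omega_i=\omega_i-\omega_0$.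
   Context: A real matrix Lie group is a Lie subgroup of the group of invertible real $m\times m$ matrices for some $m$; its Lie algebra consists of $m\times m$ matrices. The Pontryagin polynomials are defined by $\det\left(t\cdot\mathrm{id}-\frac1{2\pi}A\right)=\sum_{k=0}^m p_{k/2}(A,\dots,A)\,t^{m-k}$, where $p_{k/2}$ is the symmetric $k$-linear form on $\mathfrak g$ obtained by polarization; $p_1$ is the case $k=2$. $I^k(\mathfrak g)$ denotes the symmetric $k$-linear $\mathrm{Ad}$-invariant forms on $\mathfrak g$. $\Delta^n=\{(t_0,\dots,t_n)\in\mathbb R^{n+1}:\sum t_i=1,\ t_i\ge0\}$, oriented by $(t_1,\dots,t_n)$. $EG_n=G^{n+1}$, and $\omega_j$ is the pullback of the left Maurer-Cartan form $\omega_S(A)=S^{-1}A$ of $G$ along the $j$-th projection $G^{n+1}\to G$, $j=0,\dots,n$ (also pulled back to $\Delta^n\times EG_n$). On $\Delta^n\times EG_n$ let $\hat\omega_n=\sum_{j=0}^n t_j\,\omega_j$ and let $\kappa_n=d\hat\omega_n+\frac12[\hat\omega_n\wedge\hat\omega_n]$ be its curvature, explicitly $$\kappa_n=\sum_{j=1}^n dt_j\wedge\bar\omega_j+\tfrac12\sum_{j=1}^n(t_j^2-t_j)[\bar\omega_j\wedge\bar\omega_j]+\sum_{1\le i<j\le n}t_it_j[\bar\omega_i\wedge\bar\omega_j].$$ Shulman's construction associates to $f\in I^k(\mathfrak g)$ the forms $\chi_n(f)=\int_{\Delta^n}f\circ\bigwedge^k\kappa_n$ on $EG_n$. Integration along the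 fiber $\Delta^n$ of a $k$-form $\phi$ on $\Delta^n\times M$: $\left(\int_{\Delta^n}\phi\right)_p(u_1,\dots,u_{k-n})=\int_{\Delta^n\times\{p\}}\phi(\cdot,\dots,\cdot,\tilde u_1,\dots,\tilde u_{k-n})$, with $\tilde u_i$ lifts of $u_i$ in the last slots (and the result is $0$ if $n>k$). Wedge conventions: for a $V$-valued $j$-form $\phi$ and a $W$-valued $k$-form $\psi$, $(\phi\wedge\psi)(v_1,\dots,v_{j+k})=\frac{1}{j!k!}\sum_{\sigma\in\mathfrak S_{j+k}}\mathrm{sign}(\sigma)\,\phi(v_{\sigma(1)},\dots)\otimes\psi(v_{\sigma(j+1)},\dots)$; $[\phi\wedge\psi]$ is the same with $\otimes$ replaced by the Lie bracket. For a multilinear map $f$, $f\circ\bigwedge\phi_i=f(\phi_1,\dots,\phi_k)$ means the induced linear map on the tensor product composed with $\phi_1\wedge\dots\wedge\phi_k$. So $\mathrm{Tr}(\phi\cdot\psi\cdot\chi)$, $\mathrm{Tr}(\phi\cdot\psi)$, $\mathrm{Tr}(\phi)\cdot\mathrm{Tr}(\psi)$ come from the multilinear maps $\mathrm{Tr}(ABC)$, $\mathrm{Tr}(AB)$, $\mathrm{Tr}(A)\mathrm{Tr}(B)$. *)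

(* Defs.v *)
From mathcomp Require Import all_boot all_order all_fingroup all_algebra.
From mathcomp Require Import all_classical all_reals all_analysis.

Set Implicit Arguments.
Unset Strict Implicit.
Unset Printing Implicit Defensive.

Import Order.TTheory GRing.Theory Num.Theory.
Import numFieldNormedType.Exports.

Local Open Scope classical_set_scope.
Local Open Scope ring_scope.

(* C^oo on the open set U: every iterated directional derivative of f is
   differentiable at every point of U. *)
Definition smooth_on (R : realType) (V W : normedModType R) (U : set V)
    (f : V -> W) : Prop :=
  forall (vs : seq V) (x : V), U x ->
    differentiable (foldr (fun v g y => 'D_v g y) f vs) x.

(* A local parametrization: a map R^d -> M_m(R), relevant on param_dom only. *)
Record param (R : realType) (m d : nat) := Param {
  param_dom : set 'rV[R]_d ;
  param_map :> 'rV[R]_d -> 'M[R]_m }.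

(* A Lie subgroup of GL_m(R): a subgroup together with the structure of a
   second countable, injectively immersed (not necessarily closed) submanifold
   of M_m(R) of dimension lie_dim, given by an atlas of local parametrizations,
   for which multiplication and inversion are smooth.  Smoothness into the
   group is smoothness read in the atlas, which is finer than smoothness as a
   map into M_m(R). *)
Record lie_subgroup (R : realType) (m : nat) := LieSubgroup {
  lie_set : set 'M[R]_m ;
  lie_unit : forall S, lie_set S -> S \in unitmx ;
  lie_one : lie_set 1%:M ;
  lie_mul : forall S T, lie_set S -> lie_set T -> lie_set (S *m T) ;
  lie_inv : forall S, lie_set S -> lie_set (invmx S) ;
  lie_dim : nat ;
  lie_atlas : set (param R m lie_dim) ;
  lie_atlas_countable : countable lie_atlas ;
  lie_dom_open : forall c, lie_atlas c -> open (param_dom c) ;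
  lie_atlas_in : forall c, lie_atlas c ->
    forall x, param_dom c x -> lie_set (c x) ;
  lie_atlas_cover : forall S, lie_set S ->
    exists c x, [/\ lie_atlas c, param_dom c x & c x = S] ;
  lie_param_smooth : forall c, lie_atlas c -> smooth_on (param_dom c) c ;
  lie_param_inj : forall c, lie_atlas c ->
    forall x y, param_dom c x -> param_dom c y -> c x = c y -> x = y ;
  lie_param_immersion : forall c, lie_atlas c ->
    forall x, param_dom c x -> forall u, 'D_u c x = 0 -> u = 0 ;
  lie_transition : forall c c', lie_atlas c -> lie_atlas c' ->
    forall x x', param_dom c x -> param_dom c' x' -> c x = c' x' ->
    exists (N : set 'rV[R]_lie_dim) (h : 'rV[R]_lie_dim -> 'rV[R]_lie_dim),
      [/\ open N, N x, N `<=` param_dom c, smooth_on N h &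
        forall y, N y -> param_dom c' (h y) /\ c' (h y) = c y] ;
  lie_mul_smooth : forall c1 c2, lie_atlas c1 -> lie_atlas c2 ->
    forall x1 x2, param_dom c1 x1 -> param_dom c2 x2 ->
    exists (c : param R m lie_dim)
           (N : set ('rV[R]_lie_dim * 'rV[R]_lie_dim)%type)
           (h : 'rV[R]_lie_dim * 'rV[R]_lie_dim -> 'rV[R]_lie_dim),
      [/\ lie_atlas c, open N, N (x1, x2), smooth_on N h &
        forall y, N y ->
          [/\ param_dom c1 y.1, param_dom c2 y.2, param_dom c (h y) &
              c (h y) = c1 y.1 *m c2 y.2]] ;
  lie_inv_smooth : forall c1, lie_atlas c1 -> forall x1, param_dom c1 x1 ->
    exists (c : param R m lie_dim) (N : set 'rV[R]_lie_dim)
           (h : 'rV[R]_lie_dim -> 'rV[R]_lie_dim),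
      [/\ lie_atlas c, open N, N x1, smooth_on N h &
        forall y, N y ->
          [/\ param_dom c1 y, param_dom c (h y) &
              c (h y) = invmx (c1 y)]] }.

(* The tangent space T_S G inside M_m(R); the Lie algebra is the case S = 1. *)
Definition tangent (R : realType) (m : nat) (G : lie_subgroup R m)
    (S : 'M[R]_m) : set 'M[R]_m :=
  [set v | exists c x u,
    [/\ lie_atlas c, @param_dom _ _ (lie_dim G) c x, c x = S & 'D_u c x = v]].

(* W-valued k-forms.  V is an ambient type of both points and vectors; on a
   submanifold, only the values at its points and tangent vectors matter. *)
Definition form (V W : Type) (k : nat) := V -> ('I_k -> V) -> W.

Definition wedge (R : realType) (V W1 W2 : Type) (W : lmodType R)
    (B : W1 -> W2 -> W) (j k : nat) (phi : form V W1 j) (psi : form V W2 k) :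
    form V W (j + k) :=
  fun x v => ((j`! * k`!)%:R)^-1 *:
    \sum_(s : 'S_(j + k)) (-1) ^+ s *:
      B (phi x (fun a => v (s (lshift k a))))
        (psi x (fun b => v (s (rshift j b)))).

(* Pullback along a map which is its own differential. *)
Definition lin_pullback (V V' W : Type) (f : V -> V') (k : nat)
    (phi : form V' W k) : form V W k :=
  fun x v => phi (f x) (fun i => f (v i)).

(* Exterior derivative on an open subset of a normed space. *)
Definition flat_ext_d (R : realType) (V W : normedModType R) (k : nat)
    (a : form V W k) : form V W k.+1 :=
  fun y w => \sum_(i < k.+1)
    (-1) ^+ i *: 'D_(w i) (fun y' => a y' (fun j => w (lift i j))) y.

Definition lie_bracket (R : realType) (m : nat) (A B : 'M[R]_m) : 'M[R]_m :=
  A *m B - B *m A.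

Definition EG (R : realType) (m n : nat) := 'I_n.+1 -> 'M[R]_m.

(* The simplex is used in the coordinates (t_1, ..., t_n), which also give its
   orientation; slot i : 'I_n holds t_(i+1).  Forms on Delta^n x EG_n are
   defined on the whole affine span of Delta^n. *)
Definition DEG (R : realType) (m n : nat) := ('rV[R]_n * EG R m n)%type.

Definition bary (R : realType) (n : nat) (t : 'rV[R]_n) (j : 'I_n.+1) : R :=
  if unlift ord0 j is Some i then t ord0 i else 1 - \sum_(i < n) t ord0 i.

Definition simplex (R : realType) (n : nat) : set 'rV[R]_n :=
  [set t | forall j, 0 <= bary t j].

Definition EG_param (R : realType) (m d n : nat) (c : 'I_n.+1 -> param R m d)
    (y : 'rV[R]_n * 'M[R]_(n.+1, d)) : DEG R m n :=
  (y.1, fun j => c j (row j y.2)).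

Definition EG_dparam (R : realType) (m d n : nat) (c : 'I_n.+1 -> param R m d)
    (y w : 'rV[R]_n * 'M[R]_(n.+1, d)) : DEG R m n :=
  (w.1, fun j => 'D_(row j w.2) (c j) (row j y.2)).

Definition param_pullback (R : realType) (m d n : nat)
    (c : 'I_n.+1 -> param R m d) (W : Type) (k : nat)
    (a : form (DEG R m n) W k) : form ('rV[R]_n * 'M[R]_(n.+1, d))%type W k :=
  fun y w => a (EG_param c y) (fun i => EG_dparam c y (w i)).

(* Exterior derivative on Delta^n x EG_n, computed in a product of local
   parametrizations of G around the point; its value at tangent vectors does
   not depend on the choice of these, and it is 0 off the tangent spaces. *)
Definition ext_d (R : realType) (m n : nat) (G : lie_subgroup R m)
    (W : normedModType R) (k : nat) (a : form (DEG R m n) W k) :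
    form (DEG R m n) W k.+1 :=
  fun p v => xget 0 [set z | exists (c : 'I_n.+1 -> param R m (lie_dim G)) y w,
    [/\ forall j, lie_atlas (c j) /\ param_dom (c j) (row j y.2),
        EG_param c y = p,
        forall i, EG_dparam c y (w i) = v i &
        z = flat_ext_d (param_pullback c a) y w]].

Definition maurer_cartan (R : realType) (m : nat) :
    form 'M[R]_m 'M[R]_m 1 :=
  fun S v => invmx S *m v ord0.

Definition omega (R : realType) (m n : nat) (j : 'I_n.+1) :
    form (EG R m n) 'M[R]_m 1 :=
  lin_pullback (fun S : EG R m n => S j) (@maurer_cartan R m).

Definition omega_bar (R : realType) (m n : nat) (j : 'I_n.+1) :
    form (EG R m n) 'M[R]_m 1 :=
  fun S v => omega j S v - omega ord0 S v.

Definition omega_hat (R : realType) (m n : nat) :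
    form (DEG R m n) 'M[R]_m 1 :=
  fun p v => \sum_(j < n.+1)
    bary p.1 j *: lin_pullback (@snd 'rV[R]_n (EG R m n)) (omega j) p v.

Definition kappa (R : realType) (m n : nat) (G : lie_subgroup R m) :
    form (DEG R m n) 'M[R]_m 2 :=
  fun p v => ext_d G (@omega_hat R m n) p v
    + 2^-1 *: wedge (@lie_bracket R m) (@omega_hat R m n) (@omega_hat R m n) p v.

(* The coefficient of t^(m - k) in det (t.id - A / 2pi), and 0 for k > m. *)
Definition pontryagin_coef (R : realType) (m k : nat) (A : 'M[R]_m) : R :=
  if (k <= m)%N then (char_poly ((2 * pi)^-1 *: A))`_(m - k) else 0.

(* p_(k/2): the symmetric k-linear form whose value on the diagonal is
   pontryagin_coef k, through the polarization identity
     p(A_1,...,A_k) = 1/k! sum_(I subset {1..k}) (-1)^(k-|I|) q(sum_(i in I) A_i).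
   It is written on all of M_m(R); p_(k/2) in I^k(g) is its restriction to g. *)
Definition pontryagin (R : realType) (m k : nat) (A : 'I_k -> 'M[R]_m) : R :=
  (k`!%:R)^-1 * \sum_(I : {set 'I_k})
    (-1) ^+ (k - #|I|) * pontryagin_coef k (\sum_(i in I) A i).

Definition p1 (R : realType) (m : nat) (A B : 'M[R]_m) : R^o :=
  pontryagin (fun i : 'I_2 => if i == ord0 then A else B).

(* Iterated Lebesgue integral over R^n. *)
Fixpoint Rn_integral (R : realType) (n : nat) : ('rV[R]_n -> R) -> R :=
  if n is n'.+1 then fun f =>
    \int[lebesgue_measure]_(x in setT)
      Rn_integral (fun y : 'rV[R]_n' => f (row_mx (x%:M : 'rV[R]_1) y))
  else fun f => f 0.

Definition simplex_integral (R : realType) (n : nat) (f : 'rV[R]_n -> R) : R :=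
  Rn_integral (fun t => \1_(@simplex R n) t * f t).

(* Integration along the fibre: the coordinate fields of Delta^n fill the first
   n slots, the lifts (0, u_b) the last k - n. *)
Definition fiber_integral (R : realType) (m n k : nat)
    (phi : form (DEG R m n) R^o k) : form (EG R m n) R^o (k - n) :=
  fun S u => if (n <= k)%N then
    simplex_integral (fun t : 'rV[R]_n => phi (t, S) (fun i : 'I_k =>
      if (i < n)%N then (\row_(a < n) (a == i :> nat)%:R, fun=> 0)
      else (0, if insub (i - n)%N is Some b then u b else fun=> 0)))
  else 0.

Definition chi (R : realType) (m n : nat) (G : lie_subgroup R m) :
    form (EG R m n) R^o (4 - n) :=
  fiber_integral (wedge (@p1 R m) (kappa (n := n) G) (kappa (n := n) G)).

Arguments chi {R m} n%_nat_scope G.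

(* Equality of forms on the manifold EG_n = G^(n+1). *)
Definition eq_on_EG (R : realType) (m n k : nat) (G : lie_subgroup R m)
    (a b : form (EG R m n) R^o k) : Prop :=
  forall (S : EG R m n) (v : 'I_k -> EG R m n),
    (forall j, lie_set G (S j)) -> (forall i j, tangent G (S j) (v i j)) ->
    a S v = b S v.

Definition Tr2 (R : realType) (m n : nat) (j k : nat)
    (phi : form (EG R m n) 'M[R]_m j) (psi : form (EG R m n) 'M[R]_m k) :
    form (EG R m n) R^o (j + k) :=
  wedge (fun A B : 'M[R]_m => \tr (A *m B) : R^o) phi psi.

Definition TrTr (R : realType) (m n : nat) (j k : nat)
    (phi : form (EG R m n) 'M[R]_m j) (psi : form (EG R m n) 'M[R]_m k) :
    form (EG R m n) R^o (j + k) :=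
  wedge (fun A B : 'M[R]_m => \tr A * \tr B : R^o) phi psi.

(* The wedge of three forms for the trilinear map Tr(ABC), which factors through
   the products (A, B) |-> AB and (D, C) |-> Tr(DC). *)
Definition Tr3 (R : realType) (m n : nat) (i j k : nat)
    (phi : form (EG R m n) 'M[R]_m i) (psi : form (EG R m n) 'M[R]_m j)
    (theta : form (EG R m n) 'M[R]_m k) : form (EG R m n) R^o (i + j + k) :=
  Tr2 (wedge (@mulmx R m m m) phi psi) theta.

(* Main.v *)
Require Import Defs.
From mathcomp Require Import all_boot all_order all_fingroup all_algebra.
From mathcomp Require Import complex.
From mathcomp Require Import all_classical all_reals all_analysis.
From mathcomp Require Import ring.

Set Implicit Arguments.
Unset Strict Implicit.
Unset Printing Implicit Defensive.

Import Order.TTheory GRing.Theory Num.Theory.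
Import numFieldNormedType.Exports.

Local Open Scope classical_set_scope.
Local Open Scope ring_scope.

(** The forms [chi n] are computed pointwise, from the values of the curvature
    on coordinate fields of the simplex (vertical vectors) and on tangent
    vectors of the group (horizontal vectors).

    Algebra of [p1].  The coefficient of [t ^ (m - 2)] in a characteristic
    polynomial is the second elementary symmetric function of the eigenvalues,
    that is half of [(Tr A)^2 - Tr (A^2)] ([char_poly_e2], by triangularization
    over the complex numbers), and polarization gives
    [p1 A B = (Tr A Tr B - Tr (A B)) / (8 pi^2)] ([p1E]).

    Curvature.  In a chart the Maurer-Cartan form is [c^-1 dc].  The derivative
    of [c^-1] produces the bracket in [d omega = - omega /\ omega], and the
    second derivatives of [c] cancel by their symmetry ([derive_comm_mx], two
    applications of the mean value theorem to a second difference).  This gives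
    a formula for the curvature in which the chart no longer occurs
    ([ext_d_omega_hat], [kappaE]).  It shows that the curvature is zero on two
    vertical vectors, is [omega_bar i] on the i-th vertical vector and a
    horizontal one, and is an explicit quadratic expression in the barycentric
    coordinates on two horizontal vectors.

    Top degree.  As [p1] is symmetric and the curvature alternating, the 24
    permutations in [p1 (kappa /\ kappa)] reduce to the three pairings of the
    four slots ([wedge22]).  For n > 2 each pairing pairs two vertical vectors,
    so the integrand is zero; for n = 0 the curvature itself is zero.  For n = 2
    the integrand does not depend on the point of the simplex, whose area is
    1/2.  For n = 1 it is a multiple of [t^2 - t], with integral -1/6, and the
    three pairings contribute equally by cyclicity of the trace. *)

(** * Alternating sums over small symmetric groups *)

Lemma sum_perm_lift (V : nmodType) n (F : 'S_n.+1 -> V) :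
  \sum_s F s = \sum_(j < n.+1) \sum_(s : 'S_n) F (lift_perm ord0 j s).
Proof.
rewrite pair_bigA /= (reindex (fun p => lift_perm ord0 p.1 p.2)) //=.
apply: onW_bij; apply: inj_card_bij => [[i s] [j t] /= e|].
  have ij : i = j.
    by have := congr1 (fun u : 'S_n.+1 => u ord0) e; rewrite !lift_perm_id.
  subst j; congr (_, _); apply/permP => k.
  have := congr1 (fun u : 'S_n.+1 => u (lift ord0 k)) e.
  by rewrite !lift_perm_lift => /lift_inj.
by rewrite card_prod card_ord !card_Sn factS.
Qed.

Lemma sum_perm0 (V : nmodType) (F : 'S_0 -> V) : \sum_s F s = F 1%g.
Proof.
by rewrite (big_pred1 1%g) // => s; apply/esym/eqP/permP; case.
Qed.

Section AltSum.
Variables (R : pzRingType) (V : lmodType R).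

(** Laplace expansion along the image of the first index: the recursion by
    which the sums below are enumerated. *)
Lemma altsum_lift n (F : 'S_n.+1 -> V) :
  \sum_(s : 'S_n.+1) (-1) ^+ s *: F s =
  \sum_(j < n.+1) (-1) ^+ j *:
    \sum_(s : 'S_n) (-1) ^+ s *: F (lift_perm ord0 j s).
Proof.
rewrite sum_perm_lift; apply: eq_bigr => j _; rewrite scaler_sumr.
apply: eq_bigr => s _; rewrite scalerA; congr (_ *: _).
by rewrite odd_lift_perm /= signr_addb signr_odd.
Qed.

(** Indexing the summand by naturals lets the nested values of [lift] reduce to
    numerals by computation. *)
Lemma altsum2 (F : nat -> nat -> V) :
  \sum_(s : 'S_2) (-1) ^+ s *: F (s ord0) (s (lift ord0 ord0)) =
  F 0%N 1%N - F 1%N 0%N.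
Proof.
rewrite altsum_lift big_ord_recl big_ord1.
have S1 w (H : 'S_1 -> V) : w = H 1%g ->
    \sum_(s : 'S_1) (-1) ^+ s *: H s = w.
  move=> ->; rewrite sum_perm_lift big_ord1 sum_perm0.
  rewrite -[X in lift_perm _ _ X]/(1%g : 'S_0) lift_perm1.
  by rewrite odd_perm1 scale1r.
rewrite !(S1 _ _ erefl) !lift_perm_id !lift_perm_lift !permE /= /bump /=.
by rewrite expr0 scale1r expr1 scaleN1r.
Qed.

Lemma altsum3 (F : nat -> nat -> nat -> V) :
  \sum_(s : 'S_3) (-1) ^+ s *:
     F (s ord0) (s (lift ord0 ord0)) (s (lift ord0 (lift ord0 ord0))) =
    (F 0%N 1%N 2%N - F 0%N 2%N 1%N)
  - (F 1%N 0%N 2%N - F 1%N 2%N 0%N)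
  + (F 2%N 0%N 1%N - F 2%N 1%N 0%N).
Proof.
rewrite altsum_lift.
under eq_bigr => j _.
  under eq_bigr do rewrite lift_perm_id !lift_perm_lift.
  rewrite (altsum2 (fun a b => F j (bump j a) (bump j b))); over.
rewrite !big_ord_recl big_ord0 /= /bump /=.
by rewrite expr0 !scale1r expr1 !scaleN1r sqrrN expr1n scale1r addr0 addrA.
Qed.

Lemma altsum4 (F : nat -> nat -> nat -> nat -> V) :
  \sum_(s : 'S_4) (-1) ^+ s *:
     F (s ord0) (s (lift ord0 ord0)) (s (lift ord0 (lift ord0 ord0)))
       (s (lift ord0 (lift ord0 (lift ord0 ord0)))) =
    ((F 0%N 1%N 2%N 3%N - F 0%N 1%N 3%N 2%N)
     - (F 0%N 2%N 1%N 3%N - F 0%N 2%N 3%N 1%N)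
     + (F 0%N 3%N 1%N 2%N - F 0%N 3%N 2%N 1%N))
  - ((F 1%N 0%N 2%N 3%N - F 1%N 0%N 3%N 2%N)
     - (F 1%N 2%N 0%N 3%N - F 1%N 2%N 3%N 0%N)
     + (F 1%N 3%N 0%N 2%N - F 1%N 3%N 2%N 0%N))
  + ((F 2%N 0%N 1%N 3%N - F 2%N 0%N 3%N 1%N)
     - (F 2%N 1%N 0%N 3%N - F 2%N 1%N 3%N 0%N)
     + (F 2%N 3%N 0%N 1%N - F 2%N 3%N 1%N 0%N))
  - ((F 3%N 0%N 1%N 2%N - F 3%N 0%N 2%N 1%N)
     - (F 3%N 1%N 0%N 2%N - F 3%N 1%N 2%N 0%N)
     + (F 3%N 2%N 0%N 1%N - F 3%N 2%N 1%N 0%N)).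
Proof.
rewrite altsum_lift.
under eq_bigr => j _.
  under eq_bigr do rewrite lift_perm_id !lift_perm_lift.
  rewrite (altsum3 (fun a b c => F j (bump j a) (bump j b) (bump j c))); over.
rewrite !big_ord_recl big_ord0 /= /bump /=.
rewrite expr0 !scale1r expr1 !scaleN1r sqrrN expr1n scale1r addr0.
by rewrite exprS sqrrN expr1n mulr1 scaleN1r !addrA.
Qed.

End AltSum.

(** * The second coefficient of the characteristic polynomial *)

Lemma coef_prod_XsubC_lead (R : comNzRingType) n (a : 'I_n -> R) :
  (\prod_(i < n) ('X - (a i)%:P))`_n = 1.
Proof.
have /monicP := monic_prod_XsubC (index_enum 'I_n) xpredT a.
by rewrite lead_coefE size_prod_XsubC /index_enum -enumT size_enum_ord.
Qed.

Lemma coef_prod_XsubC_trace (R : comNzRingType) n (a : 'I_n.+1 -> R) :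
  (\prod_(i < n.+1) ('X - (a i)%:P))`_n = - \sum_i a i.
Proof.
elim: n a => [|n IH] a.
  by rewrite !big_ord1 coefB coefX coefC /= sub0r.
rewrite big_ord_recr /= mulrBr coefB coefMX coefMC /= IH coef_prod_XsubC_lead.
by rewrite [in RHS]big_ord_recr /= opprD mul1r.
Qed.

Lemma coef_prod_XsubC_e2 (R : comNzRingType) n (a : 'I_n.+2 -> R) :
  2 * (\prod_(i < n.+2) ('X - (a i)%:P))`_n =
    (\sum_i a i) ^+ 2 - \sum_i a i ^+ 2.
Proof.
elim: n a => [|n IH] a.
  rewrite !big_ord_recl !big_ord0 /= mulr1 coef0M !coefB !coefX !coefC /=.
  ring.
rewrite big_ord_recr /= mulrBr coefB coefMX coefMC /= mulrBr IH.
rewrite coef_prod_XsubC_trace !(big_ord_recr n.+2) /=.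
ring.
Qed.

Lemma char_poly_conj (R : comUnitRingType) n (P A : 'M[R]_n) :
  P \in unitmx -> char_poly (P *m A *m invmx P) = char_poly A.
Proof.
move=> uP; rewrite /char_poly.
have QP : map_mx polyC P *m map_mx polyC (invmx P) = 1%:M.
  by rewrite -map_mxM mulmxV // map_mx1.
have -> : char_poly_mx (P *m A *m invmx P) =
   map_mx polyC P *m char_poly_mx A *m map_mx polyC (invmx P).
  rewrite /char_poly_mx mulmxBr mulmxBl !map_mxM.
  by rewrite scalar_mxC -(mulmxA 'X%:M) QP mulmx1.
by rewrite !det_mulmx mulrAC -det_mulmx QP det1 mul1r.
Qed.

(** Both sides are invariant under conjugation, so Schur's theorem reduces the
    identity to triangular matrices, where the diagonal entries are the roots
    and the diagonal of the square consists of their squares. *)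
Lemma char_poly_e2_closed (C : numClosedFieldType) n (A : 'M[C]_n.+2) :
  2 * (char_poly A)`_n = (\tr A) ^+ 2 - \tr (A *m A).
Proof.
have [P /unitarymx_unit uP] := Schur A (ltn0Sn _).
rewrite /similar_to conjumx //.
set B := P *m A *m invmx P => tB.
have -> : \tr A = \tr B by rewrite /B mxtrace_mulC mulKmx.
have -> : \tr (A *m A) = \tr (B *m B).
  by rewrite /B !mulmxA mulmxKV // [RHS]mxtrace_mulC -mulmxA mulKmx.
rewrite -(char_poly_conj A uP) -/B char_poly_trig // coef_prod_XsubC_e2.
congr (_ - _); apply: eq_bigr => i _.
rewrite [RHS]mxE (bigD1 i) //= big1 ?addr0 // => j ji.
have [ij|] := ltnP i j; first by rewrite (is_trig_mxP tB _ _ ij) mul0r.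
rewrite leq_eqVlt (inj_eq val_inj) (negPf ji) /= => ij.
by rewrite (is_trig_mxP tB _ _ ij) mulr0.
Qed.

Lemma char_poly_e2 (R : rcfType) n (A : 'M[R]_n.+2) :
  2 * (char_poly A)`_n = (\tr A) ^+ 2 - \tr (A *m A).
Proof.
apply: (@complexI R).
have := char_poly_e2_closed (map_mx (real_complex R) A).
rewrite -map_char_poly coef_map -map_mxM !trace_map_mx.
by rewrite rmorphB rmorphM rmorphXn /= rmorph_nat.
Qed.

(** * The first Pontryagin polynomial *)

Lemma big_set_ord2 (V : nmodType) (F : {set 'I_2} -> V) :
  \sum_I F I = F finset.set0 + F [set ord0]%SET + F [set ord_max]%SET + F finset.setT.
Proof.
have in01 (I J : {set 'I_2}) : (ord0 \in I) = (ord0 \in J) ->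
    (ord_max \in I) = (ord_max \in J) -> I = J.
  move=> e0 e1; apply/finset.setP => -[[|[|//]] h].
    by rewrite (_ : Ordinal h = ord0) //; exact: val_inj.
  by rewrite (_ : Ordinal h = ord_max) //; exact: val_inj.
rewrite (bigD1 finset.set0) //= (bigD1 [set ord0]%SET) /=; last first.
  by apply/eqP => /finset.setP/(_ ord0); rewrite !inE.
rewrite (bigD1 [set ord_max]%SET) /=; last first.
  apply/andP; split.
    by apply/eqP => /finset.setP/(_ ord_max); rewrite !inE.
  by apply/eqP => /finset.setP/(_ ord0); rewrite !inE.
rewrite (bigD1 finset.setT) /=; last first.
  rewrite -!andbA; apply/and3P; split.
  - by apply/eqP => /finset.setP/(_ ord_max); rewrite !inE.
  - by apply/eqP => /finset.setP/(_ ord_max); rewrite !inE.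
  - by apply/eqP => /finset.setP/(_ ord0); rewrite !inE.
rewrite big1 ?addr0 ?addrA // => I /andP[/andP[/andP[I0 I1] I2] I3].
case e0 : (ord0 \in I); case e1 : (ord_max \in I).
- by move: I3; rewrite (in01 I finset.setT) ?eqxx // !inE.
- by move: I1; rewrite (in01 I [set ord0]%SET) ?eqxx // !inE.
- by move: I2; rewrite (in01 I [set ord_max]%SET) ?eqxx // !inE.
- by move: I0; rewrite (in01 I finset.set0) ?eqxx // !inE.
Qed.

(** The formula persists for m < 2, where the left-hand side is zero by
    convention: a matrix of size at most 1 has no second elementary symmetric
    function. *)
Lemma pontryagin_coef2 (R : realType) m (A : 'M[R]_m) :
  pontryagin_coef 2 A = (8 * pi ^+ 2)^-1 * ((\tr A) ^+ 2 - \tr (A *m A)).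
Proof.
rewrite /pontryagin_coef; case: m A => [|[|m]] A /=.
- by rewrite /mxtrace !big_ord0 expr0n /= subrr mulr0.
- by rewrite /mxtrace !big_ord1 mxE big_ord1 expr2 subrr mulr0.
have := char_poly_e2 ((2 * pi)^-1 *: A).
have -> : (m.+2 - 2)%N = m by rewrite subSS subSS subn0.
rewrite -scalemxAl -scalemxAr scalerA !mxtraceZ => e.
have pi0 : (pi : R) != 0 by rewrite gt_eqF ?pi_gt0.
apply: (@mulfI _ (2 : R)); first by rewrite pnatr_eq0.
by rewrite e; move: pi pi0 {e} => p p0; field; exact: p0.
Qed.

Section P1.
Variables (R : realType) (m : nat).
Implicit Types A B C : 'M[R]_m.

Lemma p1E A B : p1 A B = (8 * pi ^+ 2)^-1 * (\tr A * \tr B - \tr (A *m B)).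
Proof.
rewrite /p1 /pontryagin big_set_ord2 cards0 !cards1 cardsT card_ord.
rewrite finset.big_set0 !big_set1 /=.
rewrite (eq_bigl xpredT) => [|i]; last by rewrite inE.
rewrite !big_ord_recl big_ord0 /= addr0 !pontryagin_coef2.
rewrite !mulmxDl !mulmxDr mulmx0 !mxtraceD mxtrace0 (mxtrace_mulC B A).
have -> : (2`!)%:R = 2 :> R by [].
have pi0 : (pi : R) != 0 by rewrite gt_eqF ?pi_gt0.
by move: pi pi0 => p p0; field; exact: p0.
Qed.

Lemma p1C A B : p1 A B = p1 B A.
Proof. by rewrite !p1E (mulrC (\tr A)) (mxtrace_mulC A). Qed.

Lemma p1N A B : p1 (- A) B = - p1 A B.
Proof. by rewrite !p1E mulNmx !(raddfN (@mxtrace R m)) /=; ring. Qed.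

Lemma p1_0l A : p1 0 A = 0.
Proof. by rewrite p1E mul0mx mxtrace0 mul0r subrr mulr0. Qed.

Lemma p1Zr (k : R) A B : p1 A (k *: B) = k * p1 A B.
Proof. by rewrite !p1E -scalemxAr !mxtraceZ; ring. Qed.

Lemma p1_bracket A B C :
  p1 A (lie_bracket B C) = - (8 * pi ^+ 2)^-1 * \tr (A *m lie_bracket B C).
Proof.
rewrite p1E (_ : \tr (lie_bracket B C) = 0) ?mulr0 ?sub0r ?mulrN ?mulNr //.
by rewrite /lie_bracket raddfB /= mxtrace_mulC subrr.
Qed.

Lemma tr_bracketC A B C :
  \tr (A *m lie_bracket B C) = \tr (B *m lie_bracket C A).
Proof.
rewrite /lie_bracket !mulmxBr !raddfB /= !mulmxA.
by rewrite -(mulmxA A B) (mxtrace_mulC A) (mxtrace_mulC (A *m C)) mulmxA.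
Qed.

Lemma lie_bracketC A B : lie_bracket A B = - lie_bracket B A.
Proof. by rewrite /lie_bracket opprB. Qed.

Lemma lie_bracket0 A : lie_bracket 0 A = 0.
Proof. by rewrite /lie_bracket mul0mx mulmx0 subrr. Qed.

End P1.

(** * Directional derivatives and their symmetry *)

Section Derive.
Variable R : realType.
Implicit Types V W : normedModType R.

(** A directional derivative only sees the restriction to a line, so it can be
    transported along any map that is affine on that line. *)
Lemma derive_affine V V' W (f : V -> W) (g : V' -> V) a v w :
  (forall h : R, g (h *: w + a) = h *: v + g a) ->
  'D_w (f \o g) a = 'D_v f (g a).
Proof.
move=> gE; rewrite /derive; set F := (X in lim (X @ _)).
set H := (X in _ = lim (X @ _)).
by have -> : F = H by apply: funext => h; rewrite /F /= gE.
Qed.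

Lemma derivable_affine V V' W (f : V -> W) (g : V' -> V) a v w :
  (forall h : R, g (h *: w + a) = h *: v + g a) ->
  derivable f (g a) v -> derivable (f \o g) a w.
Proof.
move=> gE; rewrite /derivable; set F := (X in cvg (X @ _)).
set H := (X in _ -> cvg (X @ _)).
by have -> : F = H by apply: funext => h; rewrite /H /= gE.
Qed.

Lemma is_derive_affine V V' W (f : V -> W) (g : V' -> V) a v w df :
  (forall h : R, g (h *: w + a) = h *: v + g a) ->
  is_derive (g a) v f df -> is_derive a w (f \o g) df.
Proof.
move=> gE [df1 <-]; split; last by rewrite (derive_affine _ gE).
exact: derivable_affine gE df1.
Qed.

Lemma is_derive_line V W (f : V -> W) x u (s : R) df :
  is_derive (s *: u + x) u f df ->
  is_derive s 1 (fun s : R => f (s *: u + x)) df.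
Proof.
move=> d; apply: (@is_derive_affine _ _ _ f (fun s : R => s *: u + x)) d => h.
by rewrite addrA -scalerDl /= -[h *: 1]/(h * 1) mulr1.
Qed.

Lemma MVT_line V (f df : V -> R) x u (h : R) : 0 <= h ->
  (forall s, s \in `[0, h] -> is_derive (s *: u + x) u f (df (s *: u + x))) ->
  exists2 s, s \in `[0, h] & f (h *: u + x) - f x = df (s *: u + x) * h.
Proof.
move=> h0 fd.
have fd1 s : s \in `[0, h] -> is_derive s 1 (fun s : R => f (s *: u + x))
    (df (s *: u + x)) by move=> sh; apply: is_derive_line; exact: fd.
pose g (s : R) : R := f (s *: u + x).
pose dg (s : R) : R := df (s *: u + x).
have cg : {within `[0, h], continuous g}.
  by apply: derivable_within_continuous => s /fd1[].
have dgE s : s \in `]0, h[%R -> is_derive s 1 g (dg s).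
  by move=> sh; apply: fd1; exact: subset_itv_oo_cc sh.
have [s sh] := MVT_segment h0 dgE cg.
by rewrite /g scale0r add0r subr0; exists s.
Qed.

(** The mean value theorem is applied to the difference in the direction v,
    moved along u, and then to fu moved along v. *)
Lemma second_difference V (f fu fuv : V -> R) x u v (h : R) : 0 <= h ->
  (forall s t, s \in `[0, h] -> t \in `[0, h] ->
    let y := s *: u + (t *: v + x) in
    is_derive y u f (fu y) /\ is_derive y v fu (fuv y)) ->
  exists s t, [/\ s \in `[0, h], t \in `[0, h] &
    f (h *: u + (h *: v + x)) - f (h *: v + x) - (f (h *: u + x) - f x)
      = fuv (s *: u + (t *: v + x)) * h ^+ 2].
Proof.
move=> h0 H.
have h00 : 0 \in `[0, h] by rewrite in_itv/= lexx.
have hh : h \in `[0, h] by rewrite in_itv/= lexx andbT.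
have [|s sh es] := @MVT_line _ (fun y => f (h *: v + y) - f y)
    (fun y => fu (h *: v + y) - fu y) x u h h0.
  move=> s sh; apply: is_deriveB; last first.
    by have [] := H s 0 sh h00; rewrite scale0r add0r.
  have [] := H s h sh hh; rewrite addrCA => d _.
  apply: (is_derive_affine (g := fun y => h *: v + y)) d => k.
  by rewrite addrCA.
have [|t th et] := @MVT_line _ fu fuv (s *: u + x) v h h0.
  by move=> t th; have [_] := H s t sh th; rewrite addrCA.
exists s, t; split => //.
rewrite [h *: u + _]addrCA [s *: u + _]addrCA expr2 mulrA -et -es.
by ring.
Qed.

(** Schwarz's theorem.  The second difference is symmetric in u and v, so on
    arbitrarily small parallelograms at x a value of fuv equals a value of fvu;
    continuity at x concludes. *)
Lemma derive_comm V (f fu fv fuv fvu : V -> R) (U : set V) x u v :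
  open U -> U x ->
  (forall y, U y -> is_derive y u f (fu y)) ->
  (forall y, U y -> is_derive y v f (fv y)) ->
  (forall y, U y -> is_derive y v fu (fuv y)) ->
  (forall y, U y -> is_derive y u fv (fvu y)) ->
  {for x, continuous fuv} -> {for x, continuous fvu} ->
  fuv x = fvu x.
Proof.
move=> oU Ux Hu Hv Huv Hvu cuv cvu.
apply/eqP; rewrite -subr_eq0 -normr_le0; apply/ler_addgt0Pl => e e0.
rewrite addr0.
have e2 : 0 < e / 2 by rewrite divr_gt0.
have : \forall y \near x, [/\ U y, `|fuv x - fuv y| < e / 2 &
    `|fvu x - fvu y| < e / 2].
  near=> y; split; near: y.
  - exact: open_nbhs_nbhs.
  - exact: (cvgrPdist_lt _ _).1 cuv _ e2.
  - exact: (cvgrPdist_lt _ _).1 cvu _ e2.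
move=> /nbhs_normP[r /= r0 xr].
(* with this side the parallelogram lies in the ball of radius r *)
pose h := r / (1 + `|u| + `|v|).
have k0 : 0 < 1 + `|u| + `|v| by rewrite ltr_wpDr// ltr_wpDr.
have h0 : 0 < h by rewrite divr_gt0.
have small s t : s \in `[0, h] -> t \in `[0, h] -> `|s *: u + t *: v| < r.
  rewrite !in_itv /= => /andP[s0 sh] /andP[t0 th].
  rewrite (le_lt_trans (ler_normD _ _))// !normrZ !ger0_norm//.
  rewrite (@le_lt_trans _ _ (h * `|u| + h * `|v|))//.
    by rewrite lerD// ler_wpM2r.
  rewrite -mulrDr /h mulrAC ltr_pdivrMr// ltr_pM2l//.
  by rewrite -addrA ltrDr.
have nearE s t : s \in `[0, h] -> t \in `[0, h] ->
    [/\ U (s *: u + (t *: v + x)),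
    `|fuv x - fuv (s *: u + (t *: v + x))| < e / 2 &
    `|fvu x - fvu (s *: u + (t *: v + x))| < e / 2].
  move=> sh th; apply: xr; rewrite /ball_ /= addrA distrC addrK.
  exact: small.
have [|s [t [sh th E1]]] := @second_difference _ f fu fuv x u v h (ltW h0).
  move=> s t sh th y; have [Uy _ _] := nearE s t sh th.
  by split; [exact: Hu|exact: Huv].
have [|t' [s' [th' sh' E2]]] := @second_difference _ f fv fvu x v u h (ltW h0).
  move=> t' s' th' sh' y; have [] := nearE s' t' sh' th'.
  by rewrite addrCA => Uy _ _; split; [exact: Hv|exact: Hvu].
have E : fuv (s *: u + (t *: v + x)) = fvu (s' *: u + (t' *: v + x)).
  have hn : h ^+ 2 != 0 by rewrite expf_neq0// gt_eqF.
  apply: (mulIf hn); rewrite -E1 addrCA [X in fvu X]addrCA -E2.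
  by rewrite addrAC !opprB addrC !addrA; ring.
have [_ A _] := nearE s t sh th.
have [_ _ B] := nearE s' t' sh' th'.
rewrite -E in B.
move: A B; set z := fuv (_ + _) => A B.
rewrite -(subrKA z) (le_trans (ler_normD _ _))// [leRHS]splitr lerD//.
  exact: ltW A.
by rewrite distrC; exact: ltW B.
Unshelve. all: by end_near. Qed.

End Derive.

(** * Calculus of matrix-valued functions *)

Section MatrixCalculus.
Variables (R : realType) (V : normedModType R).
Implicit Types (y w : V).

Lemma is_derive_coord m n (F : V -> 'M[R]_(m, n)) y w dF i j :
  is_derive y w F dF -> is_derive y w (fun z => F z i j : R) (dF i j).
Proof.
move=> [d <-]; split; first exact: (derivable_mxP _ _ _).1 d i j.
by rewrite (derive_mx d) mxE.
Qed.

Lemma is_derive_mx m n (F : V -> 'M[R]_(m, n)) y w (dF : 'M[R]_(m, n)) :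
  (forall i j, is_derive y w (fun z => F z i j : R) (dF i j)) ->
  is_derive y w F dF.
Proof.
move=> H; have d : derivable F y w.
  by apply/derivable_mxP => i j; have [] := H i j.
split => //; rewrite (derive_mx d); apply/matrixP => i j; rewrite mxE.
by have [] := H i j.
Qed.

Lemma is_derive_bigsum (W : normedModType R) (I : Type) (r : seq I)
    (F : I -> V -> W) dF y w :
  (forall i, is_derive y w (F i) (dF i)) ->
  is_derive y w (fun z => \sum_(i <- r) F i z) (\sum_(i <- r) dF i).
Proof.
move=> H; elim: r => [|i r IH].
  rewrite big_nil; under eq_fun do rewrite big_nil; exact: is_derive_cst.
rewrite big_cons; under eq_fun do rewrite big_cons.
exact: is_deriveD.
Qed.

Lemma derivable_bigprod (I : Type) (r : seq I) (F : I -> V -> R) y w :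
  (forall i, derivable (F i) y w) ->
  derivable (fun z => \prod_(i <- r) F i z) y w.
Proof.
move=> H; elim: r => [|i r IH].
  under eq_fun do rewrite big_nil; exact: derivable_cst.
by under eq_fun do rewrite big_cons; exact: derivableM.
Qed.

Lemma is_derive_mul (f g : V -> R) y w df dg :
  is_derive y w f df -> is_derive y w g dg ->
  is_derive y w (fun z => f z * g z) (df * g y + f y * dg).
Proof.
move=> dfy dgy; have [d E] := is_deriveM dfy dgy; split => //.
by rewrite E -![_ *: _]/(_ * _) addrC [g y * _]mulrC.
Qed.

Lemma is_derive_mulmx m n p (F : V -> 'M[R]_(m, n)) (H : V -> 'M[R]_(n, p))
    y w dF dH :
  is_derive y w F dF -> is_derive y w H dH ->
  is_derive y w (fun z => F z *m H z) (dF *m H y + F y *m dH).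
Proof.
move=> dFy dHy; apply: is_derive_mx => i j.
under eq_fun do rewrite mxE.
rewrite !mxE -big_split /=; apply: is_derive_bigsum => k.
exact: is_derive_mul (is_derive_coord i k dFy) (is_derive_coord k j dHy).
Qed.

Lemma is_derive_scalemx m n (k : V -> R) (F : V -> 'M[R]_(m, n)) y w dk dF :
  is_derive y w k dk -> is_derive y w F dF ->
  is_derive y w (fun z => k z *: F z) (dk *: F y + k y *: dF).
Proof.
move=> dky dFy; apply: is_derive_mx => i j.
under eq_fun do rewrite mxE.
by rewrite !mxE; exact: is_derive_mul dky (is_derive_coord i j dFy).
Qed.

Lemma derivable_det m (F : V -> 'M[R]_m) y w :
  derivable F y w -> derivable (fun z => \det (F z)) y w.
Proof.
move=> /derivable_mxP dF.
apply: (@ex_derive _ _ _ _ _ _ (\sum_(s : 'S_m) _)).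
apply: is_derive_bigsum => s; apply: derivableP.
by apply: derivableM; [exact: derivable_cst|exact: derivable_bigprod].
Qed.

(** Derivability comes from Cramer's formula; the value is then forced by
    differentiating the constant product of F with its inverse. *)
Lemma is_derive_invmx m (F : V -> 'M[R]_m) y w dF :
  (\forall z \near y, F z \in unitmx) -> is_derive y w F dF ->
  is_derive y w (fun z => invmx (F z)) (- (invmx (F y) *m dF *m invmx (F y))).
Proof.
move=> uF dFy.
have uFy : F y \in unitmx := nbhs_singleton uF.
have d : derivable (fun z => invmx (F z)) y w.
  apply: (@near_eq_derivable _ _ _ (fun z => (\det (F z))^-1 *: \adj (F z))).
    by near=> z; rewrite /invmx ifT //; near: z.
  have [dd _] := dFy.
  apply: (@ex_derive _ _ _ _ _ _ _
    (is_derive_scalemx (derivableP _) (derivableP _))).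
    apply: derivableV; last exact: derivable_det.
    by move: uFy; rewrite unitmxE unitfE.
  apply/derivable_mxP => i j.
  under eq_fun do rewrite mxE.
  apply: derivableM; first exact: derivable_cst.
  apply: derivable_det; apply/derivable_mxP => a b.
  under eq_fun do rewrite !mxE.
  by move/derivable_mxP : dd; exact.
split => //.
have := is_derive_mulmx dFy (derivableP d).
set D := 'D_w _ _ => -[_ H].
have : dF *m invmx (F y) + F y *m D = 0.
  rewrite -H -(derive_cst (1%:M : 'M[R]_m) y w); apply: near_eq_derive.
  by near=> z; rewrite mulmxV //; near: z.
move/(congr1 (mulmx (invmx (F y)))).
rewrite mulmxDr mulKmx // mulmx0 mulmxA => /eqP.
by rewrite addrC addr_eq0 => /eqP.
Unshelve. all: by end_near. Qed.

Lemma derive_comm_mx m n (U : set V) (c : V -> 'M[R]_(m, n)) x u v :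
  open U -> smooth_on U c -> U x ->
  'D_u (fun y => 'D_v c y) x = 'D_v (fun y => 'D_u c y) x.
Proof.
move=> oU sc Ux; apply/matrixP => i j.
have d1 a y : U y -> is_derive y a c ('D_a c y).
  by move=> Uy; apply: derivableP; apply: diff_derivable; exact: (sc [::]).
have d2 a b y : U y ->
    is_derive y b (fun y => 'D_a c y) ('D_b (fun y => 'D_a c y) y).
  by move=> Uy; apply: derivableP; apply: diff_derivable; exact: (sc [:: a]).
have c2 a b :
    {for x, continuous (fun y => 'D_b (fun y => 'D_a c y) y i j : R)}.
  have := differentiable_comp (sc [:: b; a] x Ux) (differentiable_coord _ i j).
  exact: differentiable_continuous.
apply: (@derive_comm R V (fun y => c y i j) (fun y => 'D_v c y i j)
   (fun y => 'D_u c y i j) (fun y => 'D_u (fun y => 'D_v c y) y i j)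
   (fun y => 'D_v (fun y => 'D_u c y) y i j) U x v u) => //.
- by move=> y Uy; apply: is_derive_coord; exact: d1.
- by move=> y Uy; apply: is_derive_coord; exact: d1.
- by move=> y Uy; apply: is_derive_coord; exact: d2.
- by move=> y Uy; apply: is_derive_coord; exact: d2.
Qed.

End MatrixCalculus.

(** * The curvature at a point *)

Lemma wedge11 (R : realType) (V W1 W2 : Type) (W : lmodType R)
    (B : W1 -> W2 -> W) (phi : Defs.form V W1 1) (psi : Defs.form V W2 1) x v :
  wedge B phi psi x v =
    B (phi x (fun=> v ord0)) (psi x (fun=> v ord_max)) -
    B (phi x (fun=> v ord_max)) (psi x (fun=> v ord0)).
Proof.
pose F a b := B (phi x (fun=> v (inord a))) (psi x (fun=> v (inord b))).
transitivity (F 0%N 1%N - F 1%N 0%N); last first.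
  rewrite /F; congr (B (phi x _) (psi x _) - B (phi x _) (psi x _));
    by apply: funext => ?; congr v; apply: val_inj; rewrite /= inordK.
rewrite -altsum2 /wedge.
have -> : (1`! * 1`!)%:R = 1 :> R by [].
rewrite invr1 scale1r.
apply: eq_bigr => s _; congr (_ *: _); rewrite /F.
congr (B (phi x _) (psi x _)); apply: funext => i; congr v;
  rewrite inord_val; congr (s _); apply: val_inj; by rewrite ord1.
Qed.

Lemma flat_ext_d1 (R : realType) (V W : normedModType R)
    (a : Defs.form V W 1) y w :
  flat_ext_d a y w =
    'D_(w ord0) (fun z => a z (fun=> w ord_max)) y -
    'D_(w ord_max) (fun z => a z (fun=> w ord0)) y.
Proof.
rewrite /flat_ext_d big_ord_recl big_ord1 expr0 scale1r expr1 scaleN1r.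
have <- : lift ord0 ord0 = ord_max :> 'I_2 by apply: val_inj.
have e0 : (fun j : 'I_1 => w (lift ord0 j)) = (fun=> w (lift ord0 ord0)).
  by apply: funext => j; rewrite ord1.
have e1 : (fun j : 'I_1 => w (lift (lift ord0 ord0) j)) = (fun=> w ord0).
  by apply: funext => -[[|//] i]; congr w; apply: val_inj.
by rewrite e0 e1.
Qed.

Section Curvature.
Variables (R : realType) (m : nat) (G : lie_subgroup R m).

(** The exterior derivative is read in one chart for all slots, whereas each
    tangent vector comes with a chart of its own; the smooth transition maps
    carry all of them into a common chart. *)
Lemma tangent_chart (c : param R m (lie_dim G)) x v :
  lie_atlas c -> param_dom c x -> tangent G (c x) v ->
  exists u, 'D_u c x = v.
Proof.
move=> ac dx [c' [x' [u [ac' dx' cx <-]]]].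
have [N [h [oN Nx' Nc' sh hE]]] := lie_transition ac' ac dx' dx cx.
have [dhx chx] := hE x' Nx'.
have hx : h x' = x by apply: (lie_param_inj ac dhx dx); rewrite chx.
have dh : differentiable h x' := sh [::] x' Nx'.
have dc : differentiable c (h x').
  by rewrite hx; exact: (lie_param_smooth ac [::] dx).
exists ('D_u h x').
have E : 'D_('D_u h x') c (h x') = 'D_u (c \o h) x'.
  have dch := differentiable_comp dh dc.
  rewrite (deriveE _ dc) (deriveE _ dh) (deriveE _ dch).
  exact/esym/(congr1 (@^~ u) (diff_comp dh dc)).
rewrite -[in LHS]hx E.
apply: near_eq_derive; near=> y => /=.
suff /hE[] : N y by [].
by near: y; exact: open_nbhs_nbhs.
Unshelve. all: by end_near. Qed.

Lemma tangent0 S : lie_set G S -> tangent G S 0.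
Proof.
move=> /lie_atlas_cover[c [x [ac dx e]]]; exists c, x, 0; split => //.
exact: derive0.
Qed.

(** N stands for the second derivative of the chart, which enters both halves of
    the exterior derivative symmetrically. *)
Lemma skew_part (a b k : R) (M0 M1 N : 'M[R]_m) :
  a *: M1 + k *: (- (M0 *m M1) + N) - (b *: M0 + k *: (- (M1 *m M0) + N)) =
  a *: M1 - b *: M0 - k *: lie_bracket M0 M1.
Proof.
rewrite /lie_bracket; move: (M0 *m M1) (M1 *m M0) => P Q.
by apply/matrixP => i j; rewrite !mxE; ring.
Qed.

Variable n : nat.
Implicit Types p X Y : DEG R m n.

(** The differential of the affine function [bary _ j]. *)
Definition dbary (a : 'rV[R]_n) (j : 'I_n.+1) : R :=
  if unlift ord0 j is Some i then a ord0 i else - \sum_(i < n) a ord0 i.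

Lemma bary_affine (h : R) (a t : 'rV[R]_n) j :
  bary (h *: a + t) j = h * dbary a j + bary t j.
Proof.
rewrite /bary /dbary; case: (unlift _ _) => [i|]; first by rewrite !mxE.
under eq_bigr do rewrite !mxE.
by rewrite big_split /= -mulr_sumr; ring.
Qed.

Lemma dbary0 j : dbary (0 : 'rV[R]_n) j = 0.
Proof.
rewrite /dbary; case: (unlift _ _) => [i|]; first by rewrite mxE.
by rewrite big1 ?oppr0 // => i _; rewrite mxE.
Qed.

Definition omega_at p X (j : 'I_n.+1) : 'M[R]_m := invmx (p.2 j) *m X.2 j.

(** The value of [d omega_hat], expanded by the Leibniz rule and the structure
    equation of the Maurer-Cartan form. *)
Definition domega_hat p X Y : 'M[R]_m :=
  \sum_j (dbary X.1 j *: omega_at p Y j - dbary Y.1 j *: omega_at p X j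
          - bary p.1 j *: lie_bracket (omega_at p X j) (omega_at p Y j)).

Definition curvature p X Y : 'M[R]_m := domega_hat p X Y +
  lie_bracket (\sum_j bary p.1 j *: omega_at p X j)
              (\sum_j bary p.1 j *: omega_at p Y j).

Lemma is_derive_maurer_cartan (c : param R m (lie_dim G)) x u v :
  lie_atlas c -> param_dom c x ->
  is_derive x v (fun z => invmx (c z) *m 'D_u c z)
    (- ((invmx (c x) *m 'D_v c x) *m (invmx (c x) *m 'D_u c x))
     + invmx (c x) *m 'D_v (fun z => 'D_u c z) x).
Proof.
move=> ac dx.
have dc : is_derive x v c ('D_v c x).
  apply: derivableP; apply: diff_derivable.
  exact: (lie_param_smooth ac [::] dx).
have dcc : is_derive x v (fun z => 'D_u c z) ('D_v (fun z => 'D_u c z) x).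
  apply: derivableP; apply: diff_derivable.
  exact: (lie_param_smooth ac [:: u] dx).
have uc : \forall z \near x, c z \in unitmx.
  near=> z; apply: (@lie_unit _ _ G); apply: (lie_atlas_in ac).
  by near: z; apply: open_nbhs_nbhs; split=> //; exact: lie_dom_open.
have := is_derive_mulmx (is_derive_invmx uc dc) dcc.
by rewrite mulNmx !mulmxA.
Unshelve. all: by end_near. Qed.

Local Notation T := ('rV[R]_n * 'M[R]_(n.+1, lie_dim G))%type.

Lemma flat_domega_hat (c : 'I_n.+1 -> param R m (lie_dim G)) (y : T) w :
  (forall j, lie_atlas (c j) /\ param_dom (c j) (row j y.2)) ->
  flat_ext_d (param_pullback c (@omega_hat R m n)) y w =
  domega_hat (EG_param c y)
    (EG_dparam c y (w ord0)) (EG_dparam c y (w ord_max)).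
Proof.
move=> cy; pose p := EG_param c y.
(* second derivatives of the charts: the only terms that are not tensorial in
   X and Y, and the ones that cancel by symmetry *)
have [D2 D2E] : exists D2 : T -> T -> 'I_n.+1 -> 'M[R]_m, forall (X Y : T) j,
    D2 X Y j = 'D_(row j Y.2) (fun z => 'D_(row j X.2) (c j) z) (row j y.2).
  by eexists.
pose dd (X Y : T) := \sum_j (dbary Y.1 j *: omega_at p (EG_dparam c y X) j +
   bary p.1 j *: (- (omega_at p (EG_dparam c y Y) j *m
                     omega_at p (EG_dparam c y X) j)
                  + invmx (p.2 j) *m D2 X Y j)).
have H (X Y : T) :
    'D_Y (fun y' => param_pullback c (@omega_hat R m n) y' (fun=> X)) y
    = dd X Y.
  apply: derive_val; apply: is_derive_bigsum => j.
  have [acj dcj] := cy j; rewrite D2E.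
  apply: (@is_derive_scalemx _ _ _ _ (fun y' => bary y'.1 j)
    (fun y' => invmx (c j (row j y'.2)) *m
               'D_(row j X.2) (c j) (row j y'.2))).
    apply: (is_derive_affine (f := id) (g := fun y' => bary y'.1 j)).
    by move=> h; rewrite bary_affine.
  have rowE (h : R) : row j (h *: Y + y).2 = h *: row j Y.2 + row j y.2.
    by rewrite /= linearP.
  exact: (is_derive_affine (g := fun y' => row j y'.2) rowE
    (is_derive_maurer_cartan (row j X.2) (row j Y.2) acj dcj)).
transitivity (dd (w ord_max) (w ord0) - dd (w ord0) (w ord_max)).
  rewrite -(H (w ord_max)) -(H (w ord0)).
  exact: (flat_ext_d1 (param_pullback c (@omega_hat R m n)) y w).
rewrite /dd -sumrB; apply: eq_bigr => j _.
have [acj dcj] := cy j.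
have -> : D2 (w ord_max) (w ord0) j = D2 (w ord0) (w ord_max) j.
  rewrite !D2E.
  exact: (derive_comm_mx _ _ (lie_dom_open acj) (lie_param_smooth acj) dcj).
exact: skew_part.
Qed.

(** The flat computation gives the same value in all charts, and at tangent
    vectors there is a chart to compute in, so the value selected by [ext_d] is
    this one. *)
Lemma ext_d_omega_hat p v :
  (forall j, lie_set G (p.2 j)) ->
  (forall i j, tangent G (p.2 j) ((v i).2 j)) ->
  ext_d G (@omega_hat R m n) p v = domega_hat p (v ord0) (v ord_max).
Proof.
move=> Gp tv; rewrite /ext_d; case: xgetP => [z -> [c [y [w [cy <- wv ->]]]]|].
  by rewrite flat_domega_hat // !wv.
have /choice[c /choice[x cx]] := fun j => lie_atlas_cover (Gp j).
have tu i j : exists u, 'D_u (c j) (x j) = (v i).2 j.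
  have [ac dx e] := cx j; apply: tangent_chart => //; rewrite e; exact: tv.
have /choice[u uE] : forall ij : 'I_2 * 'I_n.+1,
    exists u, 'D_u (c ij.2) (x ij.2) = (v ij.1).2 ij.2.
  by move=> [i j]; exact: tu.
pose y := (p.1, \matrix_j x j).
pose w i := ((v i).1, \matrix_j u (i, j)).
move=> /(_ (flat_ext_d (param_pullback c (@omega_hat R m n)) y w)) [].
exists c, y, w; split => //.
- by move=> j; rewrite rowK; have [] := cx j.
- rewrite /EG_param /y /= [RHS]surjective_pairing; congr (_, _).
  by apply: funext => j; rewrite rowK; have [] := cx j.
- move=> i; rewrite /EG_dparam /w /= [RHS]surjective_pairing; congr (_, _).
  by apply: funext => j; rewrite !rowK; exact: (uE (i, j)).
Qed.

Lemma kappaE p v :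
  (forall j, lie_set G (p.2 j)) ->
  (forall i j, tangent G (p.2 j) ((v i).2 j)) ->
  kappa G p v = curvature p (v ord0) (v ord_max).
Proof.
move=> Gp tv; rewrite /kappa ext_d_omega_hat // wedge11; congr (_ + _).
rewrite [X in _ - X]lie_bracketC opprK scalerDr -scalerDl.
by rewrite (_ : 2^-1 + 2^-1 = 1) ?scale1r //; field.
Qed.

End Curvature.

(** * The curvature on vertical and horizontal vectors *)

Section CurvatureValues.
Variables (R : realType) (m n : nat).
Implicit Types p X Y : DEG R m n.

Lemma curvatureC p X Y : curvature p X Y = - curvature p Y X.
Proof.
rewrite /curvature opprD -lie_bracketC /domega_hat -sumrN; congr (_ + _).
apply: eq_bigr => j _; rewrite (lie_bracketC (omega_at p X j)) scalerN.
by apply/matrixP => a b; rewrite !mxE; ring.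
Qed.

Definition vert (a : 'rV[R]_n) : DEG R m n := (a, fun=> 0).
Definition horiz (U : EG R m n) : DEG R m n := (0, U).

Lemma omega_at_vert p a j : omega_at p (vert a) j = 0.
Proof. by rewrite /omega_at mulmx0. Qed.

Lemma curvature_vert_vert p a b : curvature p (vert a) (vert b) = 0.
Proof.
rewrite /curvature /domega_hat big1 => [|j _].
  rewrite [X in lie_bracket X]big1 ?lie_bracket0 ?addr0 // => j _.
  by rewrite omega_at_vert scaler0.
by rewrite !omega_at_vert lie_bracket0 !scaler0 !subrr.
Qed.

(** Moving along the i-th coordinate field increases the weight of the vertex
    i + 1 and decreases that of the vertex 0, whence the difference of
    Maurer-Cartan forms. *)
Lemma curvature_vert_horiz p (i : 'I_n) U :
  curvature p (vert (\row_(a < n) (a == i :> nat)%:R)) (horiz U) =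
  omega_bar (lift ord0 i) p.2 (fun=> U).
Proof.
rewrite /curvature [X in lie_bracket X _]big1 => [|j _]; last first.
  by rewrite omega_at_vert scaler0.
rewrite lie_bracket0 addr0 /domega_hat.
under eq_bigr do rewrite omega_at_vert lie_bracket0 !scaler0 !subr0.
rewrite big_ord_recl (bigD1 i) //= big1 => [|j ji]; last first.
  by rewrite /dbary liftK mxE (inj_eq val_inj) (negPf ji) scale0r.
rewrite /dbary liftK unlift_none mxE eqxx scale1r addr0.
rewrite (bigD1 i) //= big1 => [|j ji]; last first.
  by rewrite mxE (inj_eq val_inj) (negPf ji).
by rewrite mxE eqxx addr0 scaleN1r addrC.
Qed.

Lemma curvature_horiz_horiz p U V :
  curvature p (horiz U) (horiz V) =
  lie_bracket (\sum_j bary p.1 j *: omega_at p (horiz U) j)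
              (\sum_j bary p.1 j *: omega_at p (horiz V) j) -
  \sum_j bary p.1 j *:
    lie_bracket (omega_at p (horiz U) j) (omega_at p (horiz V) j).
Proof.
rewrite /curvature addrC; congr (_ + _); rewrite /domega_hat -sumrN.
by apply: eq_bigr => j _; rewrite !dbary0 !scale0r subrr sub0r.
Qed.

Lemma omega_barE p (i : 'I_n) U :
  omega_bar (lift ord0 i) p.2 (fun=> U) =
  omega_at p (horiz U) (lift ord0 i) - omega_at p (horiz U) ord0.
Proof. by []. Qed.

End CurvatureValues.

(** The bracket is bilinear, so its deviation from affinity along a segment is
    [a^2 - a] times its value on the increments. *)
Lemma bracket_barycentre (R : realType) m (a : R) (A0 A1 B0 B1 : 'M[R]_m) :
  lie_bracket ((1 - a) *: A0 + a *: A1) ((1 - a) *: B0 + a *: B1) -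
    ((1 - a) *: lie_bracket A0 B0 + a *: lie_bracket A1 B1) =
  (a ^+ 2 - a) *: lie_bracket (A1 - A0) (B1 - B0).
Proof.
rewrite /lie_bracket !(mulmxDl, mulmxDr, mulmxBl, mulmxBr, mulNmx, mulmxN).
rewrite -!(scalemxAl, scalemxAr).
by apply/matrixP => i j; rewrite !mxE; ring.
Qed.

(** * The integrand *)

(** Each of the three pairings of the four slots arises from 8 permutations
    with the same contribution, and 8 / (2! 2!) = 2. *)
Lemma wedge22 (R : realType) (X : Type) (W : lmodType R) (B : W -> W -> R^o)
    (phi : Defs.form X W 2) x (V : nat -> X)
    (K := fun a b : nat =>
       phi x (fun i : 'I_2 => V (if i == ord0 then a else b))) :
  (forall A C, B A C = B C A) -> (forall A C, B (- A) C = - B A C) ->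
  (forall a b, K a b = - K b a) ->
  wedge B phi phi x (fun i : 'I_4 => V i) =
  2 * (B (K 0%N 1%N) (K 2%N 3%N) - B (K 0%N 2%N) (K 1%N 3%N)
       + B (K 0%N 3%N) (K 1%N 2%N)).
Proof.
move=> BC BN KN; have BNr A C : B A (- C) = - B A C by rewrite BC BN BC.
pose F a b c d := B (K a b) (K c d).
transitivity (4^-1 * \sum_(s : 'S_4) (-1) ^+ s *:
    (F (s ord0) (s (lift ord0 ord0)) (s (lift ord0 (lift ord0 ord0)))
       (s (lift ord0 (lift ord0 (lift ord0 ord0)))) : R^o)).
  rewrite /wedge; congr (_ * _).
  apply: eq_bigr => s _; congr (_ *: _); rewrite /F /K.
  congr (B (phi x _) (phi x _)); apply: funext => -[[|[|//]] i] /=;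
    by congr (V (s _)); apply: val_inj.
rewrite (altsum4 F) /F (KN 1%N 0%N) (KN 2%N 0%N) (KN 3%N 0%N).
rewrite (KN 2%N 1%N) (KN 3%N 1%N) (KN 3%N 2%N).
rewrite !BN !BNr (BC (K 2%N 3%N)) (BC (K 1%N 3%N)) (BC (K 1%N 2%N)).
by field.
Qed.

(** Extension by zero of the arguments of a form to all natural indices, which
    makes the alternating sums of [altsum3] and [wedge22] applicable. *)
Definition ext_args (R : realType) m n k (u : 'I_k -> EG R m n) (b : nat) :
    EG R m n :=
  if insub b is Some i then u i else fun=> 0.

Lemma ext_argsE (R : realType) m n k (u : 'I_k -> EG R m n) (i : 'I_k) :
  ext_args u i = u i.
Proof. by rewrite /ext_args valK. Qed.

(** The arguments that integration along the fibre feeds to the form. *)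
Definition slot (R : realType) m n k (u : 'I_k -> EG R m n) (i : nat) :
    DEG R m n :=
  if (i < n)%N then vert m (\row_(a < n) (a == i :> nat)%:R)
  else horiz (ext_args u (i - n)%N).

Section Integrand.
Variables (R : realType) (m n : nat) (G : lie_subgroup R m).
Variables (k : nat) (u : 'I_k -> EG R m n).

Lemma slot_vert i : (i < n)%N ->
  slot u i = vert m (\row_(a < n) (a == i :> nat)%:R).
Proof. by rewrite /slot => ->. Qed.

Lemma slot_horiz i : slot u (n + i)%N = horiz (ext_args u i).
Proof. by rewrite /slot ltnNge leq_addr /= addKn. Qed.

Lemma wedge_kappa t S
    (K := fun a b => curvature (t, S) (slot u a) (slot u b)) :
  (forall j, lie_set G (S j)) -> (forall i j, tangent G (S j) (u i j)) ->
  wedge (@p1 R m) (kappa (n := n) G) (kappa (n := n) G) (t, S)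
    (fun i : 'I_4 => slot u i) =
  2 * (p1 (K 0%N 1%N) (K 2%N 3%N) - p1 (K 0%N 2%N) (K 1%N 3%N)
       + p1 (K 0%N 3%N) (K 1%N 2%N)).
Proof.
move=> GS tu.
have KE a b :
    kappa G (t, S) (fun i : 'I_2 => slot u (if i == ord0 then a else b)) =
    K a b.
  rewrite kappaE //= => i j; set c := (if _ then _ else _).
  rewrite /slot; case: ifP => _ /=; first exact: tangent0.
  by rewrite /ext_args; case: insubP => [? _ _|_]; [exact: tu|exact: tangent0].
rewrite wedge22; first by rewrite !KE.
- exact: p1C.
- exact: p1N.
- by move=> a b; rewrite !KE; exact: curvatureC.
Qed.

End Integrand.

(** * Integration over the simplex *)

Section Integrals.
Variable R : realType.

Lemma Rintegral_deriv_poly (P : {poly R}) (a b : R) : a <= b ->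
  \int[@lebesgue_measure R]_(x in `[a, b]) (P^`()).[x] = P.[b] - P.[a].
Proof.
rewrite le_eqVlt => /predU1P[->|ab].
  by rewrite set_itv1 Rintegral_set1 subrr.
rewrite /Rintegral (@continuous_FTC2 _ _ (horner P)) //.
- by apply: continuous_subspaceT => x; exact: continuous_horner.
- split.
  + by move=> x _; exact: derivable_horner.
  + by apply: cvg_at_right_filter; exact: continuous_horner.
  + by apply: cvg_at_left_filter; exact: continuous_horner.
- by move=> x _; rewrite derivE.
Qed.

Lemma Rintegral_truncated_poly (P : {poly R}) (a b : R) (f : R -> R) :
  a <= b -> (forall x, f x = if a <= x <= b then (P^`()).[x] else 0) ->
  \int[@lebesgue_measure R]_(x in setT) f x = P.[b] - P.[a].
Proof.
move=> ab fE; rewrite -Rintegral_deriv_poly // [RHS]Rintegral_mkcond.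
congr (Rintegral _ _ _); apply: funext => x; rewrite fE patchE.
rewrite (_ : (x \in `[a, b]%classic) = (a <= x <= b)) //.
by apply/idP/idP; rewrite inE /= in_itv.
Qed.

Lemma Rintegral0 (f : R -> R) : (forall x, f x = 0) ->
  \int[@lebesgue_measure R]_(x in setT) f x = 0.
Proof.
move=> f0; rewrite (@Rintegral_truncated_poly 0 0 0) // => [|x].
  by rewrite subrr.
by rewrite f0 deriv0 horner0 if_same.
Qed.

Lemma Rn_integral0 n (f : 'rV[R]_n -> R) :
  (forall t, f t = 0) -> Rn_integral f = 0.
Proof.
elim: n f => [|n IH] f f0 /=; first exact: f0.
by apply: Rintegral0 => x; apply: IH.
Qed.

Lemma simplex_integral0 n (f : 'rV[R]_n -> R) :
  (forall t, f t = 0) -> simplex_integral f = 0.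
Proof. by move=> f0; apply: Rn_integral0 => t; rewrite f0 mulr0. Qed.

Lemma row_mx_head n (x : R) (y : 'rV[R]_n) :
  (row_mx (x%:M : 'rV_1) y : 'rV_n.+1) ord0 ord0 = x.
Proof.
have := row_mxEl (x%:M : 'rV_1) y ord0 ord0.
by rewrite (_ : lshift n ord0 = ord0) ?[in RHS]mxE //; exact: val_inj.
Qed.

Lemma row_mx_tail n (x : R) (y : 'rV[R]_n) i :
  (row_mx (x%:M : 'rV_1) y : 'rV_n.+1) ord0 (lift ord0 i) = y ord0 i.
Proof.
have := row_mxEr (x%:M : 'rV_1) y ord0 i.
by rewrite (_ : rshift 1 i = lift ord0 i) //; exact: val_inj.
Qed.

Lemma simplex_integral1 (P : {poly R}) (f : 'rV[R]_1 -> R) :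
  (forall t, f t = (P^`()).[t ord0 ord0]) ->
  simplex_integral f = P.[1] - P.[0].
Proof.
move=> fE; rewrite /simplex_integral /=.
apply: Rintegral_truncated_poly => // x.
set t := row_mx _ _; have t0 : t ord0 ord0 = x.
  exact: row_mx_head.
rewrite fE t0 indicE (_ : (t \in _) = (0 <= x <= 1)).
  by case: ifP; rewrite (mul1r, mul0r).
have b0 : bary t ord0 = 1 - x by rewrite /bary unlift_none big_ord1 t0.
have b1 : bary t (lift ord0 ord0) = x by rewrite /bary liftK t0.
apply/idP/idP; rewrite inE /simplex /=.
  move=> H; move: (H ord0) (H (lift ord0 ord0)).
  by rewrite b0 b1 subr_ge0 => -> ->.
move=> /andP[x0 x1] j; case: (unliftP ord0 j) => [i|] ->.
  by rewrite ord1 b1.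
by rewrite b0 subr_ge0.
Qed.

Lemma simplex_integral2_cst (f : 'rV[R]_2 -> R) (C : R) :
  (forall t, f t = C) -> simplex_integral f = C / 2.
Proof.
move=> fE; rewrite /simplex_integral /=.
(* the slice of the triangle over x is the interval from 0 to 1 - x *)
rewrite (@Rintegral_truncated_poly (C *: ('X - 2^-1 *: 'X^2)) 0 1) // => [|x].
  by rewrite !hornerE /=; field.
pose t y : 'rV[R]_2 := row_mx (x%:M : 'rV_1) (row_mx (y%:M : 'rV_1) (0 : 'rV_0)).
have t0 y : t y ord0 ord0 = x by exact: row_mx_head.
have t1 y : t y ord0 (lift ord0 ord0) = y.
  by rewrite /t row_mx_tail row_mx_head.
have tS y : (t y \in @simplex R 2) = [&& 0 <= x, 0 <= y & x + y <= 1].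
  have b0 : bary (t y) ord0 = 1 - (x + y).
    by rewrite /bary unlift_none big_ord_recl big_ord1 t0 t1.
  have b1 : bary (t y) (lift ord0 ord0) = x by rewrite /bary liftK t0.
  have b2 : bary (t y) (lift ord0 (lift ord0 ord0)) = y.
    by rewrite /bary liftK t1.
  apply/idP/idP; rewrite inE /simplex /=.
    move=> H.
    move: (H ord0) (H (lift ord0 ord0)) (H (lift ord0 (lift ord0 ord0))).
    by rewrite b0 b1 b2 subr_ge0 => -> -> ->.
  move=> /and3P[x0 y0 xy] j; case: (unliftP ord0 j) => [i|] ->; last first.
    by rewrite b0 subr_ge0.
  case: (unliftP ord0 i) => [k|] ->; last by rewrite b1.
  by rewrite ord1 b2.
case: ifP => [/andP[x0 x1]|x01].
  rewrite (@Rintegral_truncated_poly (C *: 'X) 0 (1 - x)) ?subr_ge0 // => [|y].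
    by rewrite !poly.derivE !hornerE /=; field.
  rewrite -/(t y) indicE tS fE x0 /= lerBrDl !poly.derivE !hornerE.
  by case: ifP; rewrite (mul1r, mul0r).
apply: Rintegral0 => y; rewrite -/(t y) indicE tS.
case: and3P => [[x0 y0 xy]|_]; last by rewrite mul0r.
by move: x01; rewrite x0 (le_trans _ xy) // lerDl.
Qed.

End Integrals.

(** * The forms chi *)

Section Chi.
Variables (R : realType) (m : nat) (G : lie_subgroup R m).

Lemma chiE n S (u : 'I_(4 - n) -> EG R m n)
    (K := fun t a b => curvature (t, S) (slot u a) (slot u b)) : (n <= 4)%N ->
  (forall j, lie_set G (S j)) -> (forall i j, tangent G (S j) (u i j)) ->
  chi n G S u = simplex_integral (fun t =>
    2 * (p1 (K t 0%N 1%N) (K t 2%N 3%N) - p1 (K t 0%N 2%N) (K t 1%N 3%N)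
         + p1 (K t 0%N 3%N) (K t 1%N 2%N))).
Proof.
move=> n4 GS tu; rewrite /chi /fiber_integral n4.
congr simplex_integral; apply: funext => t.
by rewrite -(wedge_kappa t GS tu).
Qed.

(** The slots 0, 1 and 2 are vertical, and every pairing of the four slots
    pairs two of these three. *)
Lemma chi_gt2 n : (2 < n)%N -> eq_on_EG G (chi n G) (fun _ _ => 0).
Proof.
move=> n2 S u GS tu; have [n4|n4] := leqP n 4; last first.
  by rewrite /chi /fiber_integral leqNgt n4.
rewrite chiE //; apply: simplex_integral0 => t.
rewrite !(slot_vert u (_ : (0 < n)%N)) ?(slot_vert u (_ : (1 < n)%N));
  rewrite ?(slot_vert u n2); do ?by apply: leq_trans n2.
by rewrite !curvature_vert_vert !p1_0l p1C p1_0l subrr addr0 mulr0.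
Qed.

Lemma chi0 : eq_on_EG G (chi 0 G) (fun _ _ => 0).
Proof.
move=> S u GS tu; rewrite chiE //; apply: simplex_integral0 => t.
have K0 a b : curvature (t, S) (slot u a) (slot u b) = 0.
  rewrite -[a]add0n -[b]add0n !slot_horiz curvature_horiz_horiz !big_ord1.
  by rewrite /bary unlift_none big_ord0 subr0 !scale1r subrr.
by rewrite !K0 !p1_0l subrr addr0 mulr0.
Qed.

(** The 12 signed traces fall into the two cyclic orders of the three
    arguments. *)
Lemma Tr3_cube n (phi : Defs.form (EG R m n) 'M[R]_m 1) S u
    (w := fun i => phi S (fun=> ext_args u i)) :
  Tr3 phi phi phi S u = 3 * \tr (w 0%N *m lie_bracket (w 1%N) (w 2%N)).
Proof.
pose F a b c : R^o := \tr ((w a *m w b - w b *m w a) *m w c).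
transitivity (2^-1 * \sum_(s : 'S_3) (-1) ^+ s *:
    F (s ord0) (s (lift ord0 ord0)) (s (lift ord0 (lift ord0 ord0)))).
  rewrite /Tr3 /Tr2 {1}/wedge; congr (_ * _).
  apply: eq_bigr => s _; congr (_ *: _); rewrite wedge11 /F /w.
  rewrite !ext_argsE.
  congr (\tr ((phi S _ *m phi S _ - phi S _ *m phi S _) *m phi S _));
    apply: funext => i; congr (u (s _)); apply: val_inj => //;
    by case: i => -[].
rewrite (altsum3 F) /F /lie_bracket.
rewrite !mulmxBl mulmxBr !raddfB /= !mulmxA.
have cyc (A B C : 'M[R]_m) : \tr (A *m B *m C) = \tr (C *m A *m B) :> R.
  by rewrite mxtrace_mulC mulmxA.
rewrite (cyc (w 2%N) (w 0%N) (w 1%N)) (cyc (w 1%N) (w 2%N) (w 0%N)).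
rewrite (cyc (w 1%N) (w 0%N) (w 2%N)) (cyc (w 2%N) (w 1%N) (w 0%N)).
by field.
Qed.

Lemma chi1 : eq_on_EG G (chi 1 G)
        (fun S v => (24 * pi ^+ 2)^-1 *
           Tr3 (omega_bar (inord 1)) (omega_bar (inord 1))
               (omega_bar (inord 1)) S v).
Proof.
have -> : inord 1 = lift ord0 ord0 :> 'I_2.
  by apply: val_inj; rewrite /= inordK.
move=> S u GS tu; rewrite Tr3_cube chiE //.
set w := fun i => omega_bar (lift ord0 ord0) S (fun=> ext_args u i).
pose T : R := \tr (w 0%N *m lie_bracket (w 1%N) (w 2%N)).
(* the integrand is C (t^2 - t): a factor 2 from the wedge product, 3 equal
   pairings, and the sign of Tr (A B) in p1 *)
pose C : R := - 6 * (8 * pi ^+ 2)^-1 * T.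
have pi0 : (pi : R) != 0 by rewrite gt_eqF ?pi_gt0.
have K0 t i : curvature (t, S) (slot u 0%N) (slot u (1 + i)%N) = w i.
  rewrite (slot_vert u (ltn0Sn 0)) slot_horiz.
  by rewrite (@curvature_vert_horiz _ _ _ _ ord0).
have K1 t i j : curvature (t, S) (slot u (1 + i)%N) (slot u (1 + j)%N) =
    (t ord0 ord0 ^+ 2 - t ord0 ord0) *: lie_bracket (w i) (w j).
  rewrite !slot_horiz curvature_horiz_horiz !big_ord_recl !big_ord0 !addr0.
  rewrite /w !(omega_barE (t, S)) /bary unlift_none liftK big_ord1 /=.
  by set a := t _ _; exact: bracket_barycentre.
rewrite (@simplex_integral1 _ (C *: (3^-1 *: 'X^3 - 2^-1 *: 'X^2))) => [|t].
  rewrite !(hornerZ, hornerD, hornerN, hornerXn) /C -/T.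
  by move: pi pi0 => q q0; field; exact: q0.
rewrite !(K0 t 0%N) !(K0 t 1%N) !(K0 t 2%N).
rewrite !(K1 t 0%N 1%N) !(K1 t 0%N 2%N) !(K1 t 1%N 2%N).
rewrite !p1Zr !p1_bracket (tr_bracketC (w 1%N)) (tr_bracketC (w 2%N)).
rewrite (lie_bracketC (w 2%N) (w 1%N)) mulmxN raddfN /= -/T.
rewrite derivZ derivB !derivZ !derivXn.
rewrite !(hornerZ, hornerD, hornerN, hornerMn, hornerXn) /C /=.
by move: pi pi0 => q q0; field; exact: q0.
Qed.

Lemma chi2 : eq_on_EG G (chi 2 G)
        (fun S v => (8 * pi ^+ 2)^-1 *
           (Tr2 (omega_bar (inord 1)) (omega_bar (inord 2)) S v
            - TrTr (omega_bar (inord 1)) (omega_bar (inord 2)) S v)).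
Proof.
have -> : inord 1 = lift ord0 ord0 :> 'I_3.
  by apply: val_inj; rewrite /= inordK.
have -> : inord 2 = lift ord0 (lift ord0 ord0) :> 'I_3.
  by apply: val_inj; rewrite /= inordK.
move=> S u GS tu; rewrite chiE //.
pose w j i := omega_bar (lift ord0 j : 'I_3) S (fun=> ext_args u i).
have K01 t : curvature (t, S) (slot u 0%N) (slot u 1%N) = 0.
  by rewrite !slot_vert // curvature_vert_vert.
have K0 t i : curvature (t, S) (slot u 0%N) (slot u (2 + i)%N) = w ord0 i.
  rewrite (slot_vert u (ltn0Sn 1)) slot_horiz.
  by rewrite (@curvature_vert_horiz _ _ _ _ ord0).
have K1 t i : curvature (t, S) (slot u 1%N) (slot u (2 + i)%N) =
    w (lift ord0 ord0) i.
  rewrite (slot_vert u (ltnSn 1)) slot_horiz.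
  by rewrite (@curvature_vert_horiz _ _ _ _ (lift ord0 ord0)).
rewrite (@simplex_integral2_cst _ _
  (2 * (p1 (w ord0 1%N) (w (lift ord0 ord0) 0%N)
        - p1 (w ord0 0%N) (w (lift ord0 ord0) 1%N)))) => [|t].
  rewrite /Tr2 /TrTr !wedge11 !p1E.
  have w0 j : omega_bar (lift ord0 j) S (fun=> u ord0) = w j 0%N.
    by rewrite /w -(ext_argsE u).
  have w1 j : omega_bar (lift ord0 j) S (fun=> u ord_max) = w j 1%N.
    by rewrite /w -(ext_argsE u).
  by rewrite !w0 !w1; move: (8 * pi ^+ 2)^-1 => k; field.
rewrite K01 p1_0l sub0r !(K0 t 0%N) !(K0 t 1%N) !(K1 t 0%N) !(K1 t 1%N).
by rewrite [- _ + _]addrC.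
Qed.

End Chi.

Theorem lemma5p3p1 (R : realType) (m : nat) (G : lie_subgroup R m) :
  [/\ eq_on_EG G (chi 1 G)
        (fun S v => (24 * pi ^+ 2)^-1 *
           Tr3 (omega_bar (inord 1)) (omega_bar (inord 1))
               (omega_bar (inord 1)) S v),
      eq_on_EG G (chi 2 G)
        (fun S v => (8 * pi ^+ 2)^-1 *
           (Tr2 (omega_bar (inord 1)) (omega_bar (inord 2)) S v
            - TrTr (omega_bar (inord 1)) (omega_bar (inord 2)) S v)) &
      forall n : nat, n <> 1%N -> n <> 2%N ->
        eq_on_EG G (chi n G) (fun _ _ => 0)].
Proof.
split; [exact: chi1|exact: chi2|].
by case=> [|[//|[//|n]]] _ _; [exact: chi0|exact: chi_gt2].
Qed.
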